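(* Let $M\to N$ be a matroid perspective on a linearly ordered set $E$. Let $B\subseteq E$ be independent in $M$ and spanning in $N$, and let $A\in[\,B\setminus \mathrm{Int}_N(B),\ B\cup \mathrm{Ext}_M(B)\,]$, i.e. $B\setminus \mathrm{Int}_N(B)\subseteq A\subseteq B\cup \mathrm{Ext}_M(B)$. Then $$r_M(A)-r_N(A)=r_M(B)-r_N(B).$$
   Context: All ground sets are finite. An ordered pair $(M,N)$ of matroids on the same set $E$ is a matroid perspective (also called quotient map or strong map), denoted $M\to N$, if every circuit of $M$ is a union of circuits of $N$; equivalently, every flat of $N$ is a flat of $M$; equivalently, $r_N(X)-r_N(Y)\le r_M(X)-r_M(Y)$ for all $Y\subseteq X\subseteq E$; equivalently, no circuit of $M$ and cocircuit of $N$ intersect in exactly one element. Here $r_M,r_N$ denote the rank functions of $M$ and $N$. For a matroid $M$ on a linearly ordered set $E$ and $A\subseteq E$, define $$\mathrm{Int}_M(A)=\{e\in A\mid e=\min(C)\text{ for some cocircuit } C \text{ of } M \text{ contained in } (E\setminus A)\cup\{e\}\},$$ $$\mathrm{Ext}_M(A)=\{e\in E\setminus A\mid e=\min(C)\text{ for some circuit } C\text{ of } M\text{ contained in } A\cup\{e\}\}.$$ The set $\mathrm{Int}_N(B)$ is defined in the same way using the matroid $N$. *)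

(* Defs.v *)
From mathcomp Require Import all_boot all_order.

Set Implicit Arguments.
Unset Strict Implicit.
Unset Printing Implicit Defensive.

(* The ground set of a matroid is the whole finite type E. *)
Record matroid (E : finType) := Matroid {
  indep : pred {set E};
  indep0 : indep set0;
  indepS : forall I J : {set E}, I \subset J -> indep J -> indep I;
  indep_aug : forall I J : {set E}, indep I -> indep J -> #|I| < #|J| ->
    exists2 e, e \in J :\: I & indep (e |: I)
}.

Section Matroid.
Variables (E : finType) (M : matroid E).
Implicit Types (A B C I J X Y : {set E}).

Definition basis B := maxset (indep M) B.

Definition circuit C := minset (fun X => ~~ indep M X) C.

Definition rank A : nat := \max_(I : {set E} | (I \subset A) && indep M I) #|I|.

Definition spanning A := rank A == rank [set: E].

(* Independent sets of the dual, whose bases are the complements of the bases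
   of M. *)
Definition coindep X := [exists B, basis B && (X \subset ~: B)].

Lemma basis_indep B : basis B -> indep M B.
Proof. exact: maxsetp. Qed.

Lemma basis_max B J : basis B -> indep M J -> #|J| <= #|B|.
Proof.
move=> /maxsetP[iB maxB] iJ; rewrite leqNgt; apply/negP => ltBJ.
have [e /setDP[_ eB] ieB] := indep_aug iB iJ ltBJ.
by move: eB; rewrite -(maxB _ ieB (subsetUr _ _)) setU11.
Qed.

Lemma indep_extend I B : indep M I -> basis B ->
  exists J, [/\ basis J, I \subset J & J \subset I :|: B].
Proof.
move=> iI bB.
pose P X := indep M X && (X \subset I :|: B).
have PI : P I by rewrite /P iI subsetUl.
have [J /maxsetP[/andP[iJ sJ] maxJ] sIJ] := maxset_exists PI.
exists J; split=> //.
have leBJ : #|B| <= #|J|.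
  rewrite leqNgt; apply/negP => ltJB.
  have [e /setDP[eB eJ] ieJ] := indep_aug iJ (basis_indep bB) ltJB.
  move: eJ; rewrite -(maxJ (e |: J)) ?setU11 ?subsetUr // /P ieJ /=.
  by rewrite subUset sJ sub1set inE eB orbT.
apply/maxsetP; split=> // K iK sJK; apply/eqP; rewrite eq_sym eqEcard sJK /=.
exact: leq_trans (basis_max bB iK) leBJ.
Qed.

Lemma coindep0 : coindep set0.
Proof.
have [B mB _] := maxset_exists (indep0 M).
by apply/existsP; exists B; rewrite sub0set andbT.
Qed.

Lemma coindepS X Y : X \subset Y -> coindep Y -> coindep X.
Proof.
move=> sXY /existsP[B /andP[bB sY]]; apply/existsP; exists B.
by rewrite bB (subset_trans sXY).
Qed.

Lemma coindep_aug X Y : coindep X -> coindep Y -> #|X| < #|Y| ->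
  exists2 e, e \in Y :\: X & coindep (e |: X).
Proof.
move=> /existsP[B /andP[bB XB]] /existsP[B' /andP[bB' YB']] ltXY.
have iB'X : indep M (B' :\: X) := indepS (subsetDl _ _) (basis_indep bB').
have [J [bJ sJ JB]] := indep_extend iB'X bB.
have JX : X \subset ~: J.
  apply/subsetP => x xX; rewrite inE; apply/negP => /(subsetP JB).
  by rewrite !inE xX /=; have := subsetP XB _ xX; rewrite inE => /negbTE->.
have [sYJ|/subsetPn[e eYX eJ]] := boolP (Y :\: X \subset J); last first.
  exists e => //; apply/existsP; exists J.
  by rewrite bJ subUset JX sub1set inE eJ.
have disj : [disjoint B' :\: X & Y :\: X].
  rewrite disjoint_sym disjoints_subset; apply/subsetP => y /setDP[yY _].
  by have := subsetP YB' _ yY; rewrite !inE negb_and => ->; rewrite orbT.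
have le1 : #|B' :\: X| + #|Y :\: X| <= #|J|.
  by rewrite -cardsUI (disjoint_setI0 disj) cards0 addn0 subset_leq_card //
    subUset sJ sYJ.
have le2 : #|B' :&: X| <= #|X :\: Y|.
  apply/subset_leq_card/subsetP => x /setIP[xB' xX]; rewrite !inE xX andbT.
  by apply: contraL xB' => /(subsetP YB'); rewrite inE.
have le3 : #|X :\: Y| < #|Y :\: X|.
  by rewrite -(ltn_add2l #|X :&: Y|) cardsID setIC cardsID.
have := leq_trans le1 (basis_max bB' (basis_indep bJ)).
by rewrite -(cardsID X B') addnC leq_add2r leqNgt (leq_ltn_trans le2 le3).
Qed.

Definition dual : matroid E := Matroid coindep0 coindepS coindep_aug.

End Matroid.

Definition cocircuit (E : finType) (M : matroid E) (C : {set E}) :=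
  circuit (dual M) C.

(* The relation M -> N, also called a quotient or strong map. *)
Definition perspective (E : finType) (M N : matroid E) : Prop :=
  forall C : {set E}, circuit M C ->
    exists2 S : {set {set E}}, (forall D, D \in S -> circuit N D) & C = cover S.

Section Activities.
Variables (d : Order.disp_t) (E : finOrderType d) (M : matroid E).

Definition is_min (e : E) (C : {set E}) :=
  (e \in C) && [forall x in C, (e <= x)%O].

Definition Int (A : {set E}) : {set E} :=
  [set e in A | [exists C : {set E},
     [&& cocircuit M C, is_min e C & C \subset ~: A :|: [set e]]]].

Definition Ext (A : {set E}) : {set E} :=
  [set e in ~: A | [exists C : {set E},
     [&& circuit M C, is_min e C & C \subset A :|: [set e]]]].

End Activities.

(* Main.v *)
Require Import Defs.
From mathcomp Require Import all_boot all_order all_algebra.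

(** Write [P = B \ A] for the elements of [B] that are dropped and [Q = A \ B]
    for those that are added, so that [P] consists of internally active
    elements of [N] and [Q] of externally active elements of [M].

    The heart of the matter is that these two kinds of activity do not
    interact.  Let [C] be a circuit of [M] inside [e |: B] with minimum [e]
    outside [B], and [D] a cocircuit of [N] inside [p |: ~: B] with minimum [p]
    in [B].  Then [C :&: D] is contained in [{e, p}], and since [M -> N] is a
    perspective it cannot be a singleton; were it equal to [{e, p}], minimality
    would give both [e <= p] and [p <= e].  So [C] and [D] are disjoint
    ([active_disjoint]).

    Two rank computations follow.  The circuits witnessing the elements of [Q]
    avoid [P], so each element of [Q] is spanned in [M] by [B \ P], and
    [r_M(A) = |B \ P| = r_M(B) - |P|] ([rank_add_active]).  Dually, the
    cocircuits witnessing the elements of [P] avoid [Q], so every element of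
    [P] is a coloop of the restriction of [N] to [B :|: Q], which is spanning;
    removing these coloops gives [r_N(A) = r_N(B) - |P|] ([rank_drop_active]).
    The two ranks drop by the same amount. *)

Section Rank.
Set Implicit Arguments. Unset Strict Implicit.
Variables (E : finType) (M : matroid E).
Implicit Types (A B C D I J X : {set E}).

Lemma indep_leq_rank I A : I \subset A -> indep M I -> #|I| <= rank M A.
Proof.
move=> sIA iI; rewrite /rank.
by apply: (@leq_bigmax_cond _ _ (fun I : {set E} => #|I|)); rewrite sIA.
Qed.

(** By augmentation, an independent set that is merely inclusion-maximal in [A]
    already has maximum cardinality. *)
Lemma rank_maximal I A : I \subset A -> indep M I ->
  (forall e, e \in A :\: I -> ~~ indep M (e |: I)) -> rank M A = #|I|.
Proof.
move=> sIA iI maxI; apply/eqP; rewrite eqn_leq indep_leq_rank // andbT.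
apply/bigmax_leqP => J /andP[sJA iJ]; rewrite leqNgt; apply/negP => ltIJ.
have [e /setDP[eJ eI] ieI] := indep_aug iI iJ ltIJ.
by have := maxI e; rewrite inE eI (subsetP sJA) // ieI => /(_ isT).
Qed.

Lemma rank_indep I : indep M I -> rank M I = #|I|.
Proof. by move=> iI; apply: rank_maximal => // e; rewrite setDv inE. Qed.

Lemma indep_of_rank A : exists J, [/\ J \subset A, indep M J & #|J| = rank M A].
Proof.
have P0 : (set0 \subset A) && indep M set0 by rewrite sub0set indep0.
rewrite /rank (@bigmax_eq_arg _ set0 _ (fun I : {set E} => #|I|) P0).
by case: arg_maxnP => // J /andP[sJA iJ] _; exists J.
Qed.

Lemma spanning_basis B : spanning M B ->
  exists J, [/\ J \subset B, basis M J & #|J| = rank M B].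
Proof.
move=> /eqP spB; have [J [sJB iJ cJ]] := indep_of_rank B.
exists J; split=> //; apply/maxsetP; split=> // K iK sJK.
apply/eqP; rewrite eq_sym eqEcard sJK cJ spB.
by rewrite indep_leq_rank ?subsetT.
Qed.

Lemma circuit_dep C X : circuit M C -> C \subset X -> ~~ indep M X.
Proof. by move=> /minsetp dC sCX; apply: contra dC; apply: indepS. Qed.

Lemma cocircuit_meets_basis D J : cocircuit M D -> basis M J ->
  exists2 x, x \in D & x \in J.
Proof.
move=> /minsetp dD bJ; have : ~~ (D \subset ~: J).
  by apply: contra dD => sDJ; apply/existsP; exists J; rewrite bJ.
by case/subsetPn=> x xD; rewrite inE negbK; exists x.
Qed.

(** If [C] and [D] met only in [x], a basis avoiding [D :\ x] could be exchanged
    for one that contains [C :\ x] and still avoids [D :\ x]; it cannot contain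
    [x], as it would contain [C], so it would miss [D] altogether. *)
Lemma circuit_cocircuit_meet C D x : circuit M C -> cocircuit M D ->
  x \in C -> x \in D -> exists y, [/\ y != x, y \in C & y \in D].
Proof.
move=> cC cD xC xD.
have [/existsP[y /and3P[]]|] := boolP [exists y, [&& y != x, y \in C & y \in D]].
  by exists y.
rewrite negb_exists => /forallP meetx.
have iCx : indep M (C :\ x).
  apply: contraT => dCx; case/minsetP: cC => _ minC.
  by move: xC; rewrite -(minC _ dCx (subsetDl _ _)) setD11.
have : indep (dual M) (D :\ x).
  apply: contraT => dDx; case/minsetP: cD => _ minD.
  by move: xD; rewrite -(minD _ dDx (subsetDl _ _)) setD11.
move=> /existsP[B /andP[bB /subsetP sDB]].
have [J [bJ sCJ /subsetP sJ]] := indep_extend iCx bB.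
have xJ : x \notin J.
  apply/negP => xJ; have := circuit_dep cC (X := J).
  by rewrite (basis_indep bJ) -(setD1K xC) subUset sub1set xJ sCJ => /(_ isT).
have [y yD yJ] := cocircuit_meets_basis cD bJ.
have yx : y != x by apply: contraNneq xJ => <-.
have := meetx y; have := sJ y yJ; have := sDB y.
by rewrite !inE yx yD /= => /(_ isT) /negbTE->; rewrite orbF => ->.
Qed.

End Rank.

(** The circuit of [N] inside [C] through [x] already provides the second
    common element. *)
Lemma perspective_meet (E : finType) (M N : matroid E) (C D : {set E}) (x : E) :
  perspective M N -> circuit M C -> cocircuit N D -> x \in C -> x \in D ->
  exists y, [/\ y != x, y \in C & y \in D].
Proof.
move=> hMN cC cD xC xD; have [S cS defC] := hMN C cC.
have /bigcupP[C' SC' xC'] : x \in cover S by rewrite -defC.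
have [y [yx yC' yD]] := circuit_cocircuit_meet (cS _ SC') cD xC' xD.
by exists y; split=> //; rewrite defC; apply/bigcupP; exists C'.
Qed.

Section Activities.
Set Implicit Arguments. Unset Strict Implicit.
Variables (d : Order.disp_t) (E : finOrderType d) (M N : matroid E).
Hypothesis hMN : perspective M N.
Implicit Types (A B C D : {set E}).

Lemma active_disjoint B C D e p :
    circuit M C -> is_min e C -> C \subset B :|: [set e] -> e \notin B ->
    cocircuit N D -> is_min p D -> D \subset ~: B :|: [set p] -> p \in B ->
  [disjoint C & D].
Proof.
move=> cC /andP[_ /forall_inP minC] /subsetP sC eB.
move=> cD /andP[_ /forall_inP minD] /subsetP sD pB.
have CDep z : z \in C -> z \in D -> z = e \/ z = p.
  move=> /sC; rewrite !inE => /orP[zB|/eqP]; last by left.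
  by move=> /sD; rewrite !inE zB => /eqP; right.
apply/pred0P => x /=; apply/negP => /andP[xC xD].
have [y [yx yC yD]] := perspective_meet hMN cC cD xC xD.
have ep : e \in C /\ e \in D -> p \in C /\ p \in D -> False.
  move=> [eC eD] [pC pD]; have /eqP eqep : e == p.
    by rewrite Order.POrderTheory.eq_le minC // minD.
  by rewrite eqep pB in eB.
have [xe|xp] := CDep x xC xD; have [ye|yp] := CDep y yC yD; subst.
- by rewrite eqxx in yx.
- exact: ep.
- exact: ep.
- by rewrite eqxx in yx.
Qed.

Section Interval.
Variables A B : {set E}.
Hypotheses (hBA : B :\: Int N B \subset A) (hAB : A \subset B :|: Ext M B).

Lemma dropped_active p : p \in B :\: A -> p \in Int N B.
Proof.
case/setDP=> pB; apply: contraNT => pI.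
by apply: (subsetP hBA); rewrite inE pI.
Qed.

Lemma added_active e : e \in A -> e \notin B -> e \in Ext M B.
Proof. by move=> /(subsetP hAB); rewrite in_setU => /orP[->|]. Qed.

(** [A :&: B] is independent, and it spans [A] because the circuit witnessing
    the activity of an element of [A] outside [B] avoids [B :\: A]. *)
Lemma rank_add_active : indep M B -> rank M A = #|A :&: B|.
Proof.
move=> iB; apply: rank_maximal; rewrite ?subsetIl //.
  exact: indepS (subsetIr _ _) iB.
move=> e /setDP[eA]; rewrite inE eA /= => eB.
have := added_active eA eB; rewrite inE => /andP[_ /existsP[C /and3P[cC mC sC]]].
apply: (circuit_dep cC); apply/subsetP => x xC.
have := subsetP sC x xC; rewrite !inE => /orP[xB|->//].
rewrite xB andbT; have [|xA] := boolP (x \in A); first by rewrite orbT.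
have /dropped_active : x \in B :\: A by rewrite inE xA.
rewrite inE => /andP[_ /existsP[D /and3P[cD mD sD]]].
have CD0 := active_disjoint cC mC sC eB cD mD sD xB.
by have := disjointFr CD0 xC; case/andP: mD => ->.
Qed.

(** Each dropped element [p] is a coloop of the restriction of [N] to
    [A :|: B]. *)
Lemma dropped_cocircuit p : p \in B :\: A ->
  exists2 D, cocircuit N D & forall x, x \in D -> x \in A :|: B -> x = p.
Proof.
move=> pBA; have := dropped_active pBA; have /setDP[pB _] := pBA.
rewrite inE => /andP[_ /existsP[D /and3P[cD mD sD]]].
exists D => // x xD xAB; have := subsetP sD x xD.
rewrite !inE => /orP[xB|/eqP //].
have xA : x \in A by move: xAB; rewrite inE (negbTE xB) orbF.
have := added_active xA xB.
rewrite inE => /andP[_ /existsP[C /and3P[cC mC sC]]].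
have CD0 := active_disjoint cC mC sC xB cD mD sD pB.
by have := disjointFl CD0 xD; case/andP: mC => ->.
Qed.

Lemma dropped_sub_basis J : basis N J -> J \subset A :|: B -> B :\: A \subset J.
Proof.
move=> bJ /subsetP sJ; apply/subsetP => p /dropped_cocircuit[D cD Dp].
have [x xD xJ] := cocircuit_meets_basis cD bJ.
by rewrite -(Dp x xD (sJ x xJ)).
Qed.

(** A basis [J] of [N] inside [B] contains all dropped elements, and [J]
    deprived of them is maximal independent in [A]: a larger independent subset
    of [A] would extend, by elements of [J], to a basis that regains all dropped
    elements and hence contains [J] strictly. *)
Lemma rank_drop_active : spanning N B -> rank N A + #|B :\: A| = rank N B.
Proof.
move=> /spanning_basis[J [sJB bJ <-]].
have sJ : J \subset A :|: B := subset_trans sJB (subsetUr _ _).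
have sPJ := dropped_sub_basis bJ sJ.
have sIA : J :\: (B :\: A) \subset A.
  apply/subsetP => x; rewrite !inE negb_and negbK.
  by case/andP=> /orP[//|xB] /(subsetP sJB); rewrite (negbTE xB).
rewrite -(cardsID (B :\: A) J) (setIidPr sPJ) addnC; congr (_ + _).
apply: rank_maximal => //.
  exact: indepS (subsetDl _ _) (basis_indep bJ).
move=> e /setDP[eA eI]; apply/negP => ieI.
have eJ : e \notin J by apply: contra eI => eJ; rewrite !inE eA eJ.
have [K [bK sIK sKJ]] := indep_extend ieI bJ.
have sPK : B :\: A \subset K.
  apply: dropped_sub_basis => //; apply: subset_trans sKJ _.
  rewrite !subUset sub1set inE eA sJ andbT /=.
  exact: subset_trans sIA (subsetUl _ _).
move: sIK; rewrite subUset sub1set => /andP[eK sIK].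
have sJK : J \subset K.
  by rewrite -(setID J (B :\: A)) subUset sIK (subset_trans (subsetIr _ _)).
case/maxsetP: bJ => _ maxJ.
by rewrite (maxJ K (basis_indep bK) sJK) in eK; rewrite eK in eJ.
Qed.

End Interval.
End Activities.

Local Open Scope ring_scope.

Theorem proposition11 (d : Order.disp_t) (E : finOrderType d)
    (M N : matroid E) (hMN : perspective M N)
    (B : {set E}) (hBM : indep M B) (hBN : spanning N B)
    (A : {set E}) (hBA : B :\: Int N B \subset A)
    (hAB : A \subset B :|: Ext M B) :
  (rank M A)%:Z - (rank N A)%:Z = (rank M B)%:Z - (rank N B)%:Z.
Proof.
rewrite (rank_add_active hMN hBA hAB hBM) (rank_indep hBM).
rewrite -(rank_drop_active hMN hBA hAB hBN) -(cardsID A B) setIC !PoszD.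
by rewrite GRing.opprD GRing.addrACA GRing.subrr GRing.addr0.
Qed.
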